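(* Let $1\le p<\infty$ and $0<s<1$ be such that $1<sp<2$. Then the indicator function $\chi_{[0,\infty)}:\mathbb R\to\mathbb R$ satisfies $$\chi_{[0,\infty)}\in\left(\tilde W^{s-1/p,p}_{\le1}(\mathbb R)\cap\tilde W^{s+1/p,p}_{\ge1}(\mathbb R)\right)\setminus\dot W^{s-1/p,p}(\mathbb R).$$
   Context: For $g\in L^p_{\rm loc}(\mathbb R)$ and $\sigma>0$: $g\in\dot W^{\sigma,p}(\mathbb R)$ iff $\int_{\mathbb R}\int_{\mathbb R}\frac{|g(x)-g(y)|^p}{|x-y|^{1+\sigma p}}\,dy\,dx<\infty$; $g\in\tilde W^{\sigma,p}_{\le1}(\mathbb R)$ iff $\int_{\mathbb R}\int_{|x-y|<1}\frac{|g(x)-g(y)|^p}{|x-y|^{1+\sigma p}}\,dy\,dx<\infty$; $g\in\tilde W^{\sigma,p}_{\ge1}(\mathbb R)$ iff $\int_{\mathbb R}\int_{|x-y|\ge1}\frac{|g(x)-g(y)|^p}{|x-y|^{1+\sigma p}}\,dy\,dx<\infty$. *)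

(* Defs.v *)
From mathcomp Require Import all_boot all_order all_algebra.
From mathcomp Require Import all_classical all_reals all_analysis.

Set Implicit Arguments.
Unset Strict Implicit.
Unset Printing Implicit Defensive.

Import Order.TTheory GRing.Theory Num.Theory.
Import numFieldNormedType.Exports.

Local Open Scope classical_set_scope.
Local Open Scope ring_scope.
Local Open Scope ereal_scope.

(* Functions are genuine Borel functions rather than classes modulo a.e.
   equality; all the conditions below are invariant under a.e. equality of
   Borel functions. Here 1 <= p < +oo is a real exponent. *)
Definition Lploc {R : realType} (p : R) : set (R -> R) :=
  [set g : R -> R | measurable_fun [set: R] g /\
     forall K : set R, compact K ->
       \int[lebesgue_measure]_(x in K) (`|g x| `^ p)%:E < +oo].

(* The inner variable y ranges over D x. On the diagonal x = y the integrand
   is 0 (0 `^ p = 0 for p != 0), which is harmless since for each x this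
   concerns a single point y. *)
Definition gagliardo {R : realType} (D : R -> set R) (sigma p : R)
    (g : R -> R) : \bar R :=
  \int[lebesgue_measure]_x \int[lebesgue_measure]_(y in D x)
    ((`|g x - g y| `^ p) / (`|x - y| `^ (1 + sigma * p)))%:E.

(* The three spaces below are meant for sigma > 0. *)
Definition Wdot {R : realType} (sigma p : R) : set (R -> R) :=
  [set g : R -> R | Lploc p g /\ gagliardo (fun=> setT) sigma p g < +oo].

Definition Wtilde_le1 {R : realType} (sigma p : R) : set (R -> R) :=
  [set g : R -> R | Lploc p g /\
     gagliardo (fun x => [set y | (`|x - y| < 1)%R]) sigma p g < +oo].

Definition Wtilde_ge1 {R : realType} (sigma p : R) : set (R -> R) :=
  [set g : R -> R | Lploc p g /\
     gagliardo (fun x => [set y | (1 <= `|x - y|)%R]) sigma p g < +oo].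

(* Main.v *)
(* Only pairs of opposite signs contribute, and for them |x - y| = |x| + |y|
   =: t.  Writing the kernel as t^(-2 gamma), both t^(-gamma) <= w x and
   t^(-gamma) <= w y hold with w u = min(|u|^(-alpha), |u|^(-beta)), when
   gamma = alpha and t <= 1, or gamma = beta and t >= 1.  If alpha < 1 < beta,
   then w is integrable, so the double integral is at most (int w)^2.  On the
   whole plane, the square [r, 2r[ x [-r, 0[ alone contributes at least
   r^2 (3r)^(-(1 + sigma p)), which is unbounded in r when sigma p < 1. *)
Require Import Defs.
From mathcomp Require Import all_boot all_order all_algebra.
From mathcomp Require Import all_classical all_reals all_analysis.
From mathcomp Require Import measurable_realfun ring lra.

Set Implicit Arguments.
Unset Strict Implicit.
Unset Printing Implicit Defensive.

Import Order.TTheory GRing.Theory Num.Theory.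
Import numFieldNormedType.Exports.

Local Open Scope classical_set_scope.
Local Open Scope ring_scope.

(** * Comparison of integrals, and power functions *)

(** The integral of a nonnegative function is a supremum over the simple functions below it, and
    this set only grows with the function. The comparison thus covers inner integrals and arbitrary
    domains [D x]. *)
Lemma ge0_le_integral_subset (d : measure_display) (T : measurableType d)
    (R : realType) (mu : {measure set T -> \bar R}) (A B : set T)
    (f1 f2 : T -> \bar R) :
  A `<=` B ->
  (forall x, A x -> 0 <= f1 x)%E -> (forall x, B x -> 0 <= f2 x)%E ->
  (forall x, A x -> f1 x <= f2 x)%E ->
  (\int[mu]_(x in A) f1 x <= \int[mu]_(x in B) f2 x)%E.
Proof.
move=> AB f10 f20 f12; rewrite (integral_mkcond A) (integral_mkcond B).
rewrite !ge0_integralTE; [|exact: erestrict_ge0..].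
apply: ereal_sup_le => _ [h hf <-]; exists h => // x.
apply: (le_trans (hf x)); apply: (@le_trans _ _ ((f2 \_ A) x)).
  exact: lee_restrict.
exact: restrict_lee.
Qed.

Lemma ler_powRN (R : realType) (r u v : R) :
  0 <= r -> 0 < u -> u <= v -> v `^ (- r) <= u `^ (- r).
Proof.
move=> r0 u0 uv; rewrite !powRN lef_pV2 ?posrE ?powR_gt0//.
  by apply: ge0_ler_powR; rewrite ?nnegrE ?(le_trans (ltW u0) uv) ?(ltW u0).
exact: lt_le_trans uv.
Qed.

Lemma continuous_powRl (R : realType) (r x : R) :
  0 < x -> {for x, continuous (@powR R ^~ r)}.
Proof.
move=> x0; apply: differentiable_continuous; apply/derivable1_diffP.
by apply: derivable_powR; rewrite in_itv/= x0.
Qed.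

Lemma within_continuous_powR (R : realType) (r a b : R) :
  0 < a -> {within `[a, b], continuous (@powR R ^~ r)}.
Proof.
move=> a0; apply: continuous_in_subspaceT => x /set_mem/=.
by rewrite in_itv/= => /andP[ax _]; exact/continuous_powRl/(lt_le_trans a0).
Qed.

Lemma integral_powR (R : realType) (r a b : R) : r != 1 -> 0 < a -> a < b ->
  (\int[lebesgue_measure]_(x in `[a, b]) (x `^ (- r))%:E =
   ((b `^ (1 - r) - a `^ (1 - r)) / (1 - r))%:E)%E.
Proof.
move=> r1 a0 ab; have r1' : 1 - r != 0 by rewrite subr_eq0 eq_sym.
pose F (x : R) : R := (1 - r)^-1 * x `^ (1 - r).
have dF (x : R) : 0 < x -> is_derive x 1 F (x `^ (- r)).
  move=> x0; rewrite /F.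
  have := @is_deriveZ _ _ _ _ (1 - r)^-1 _ _ _ (is_derive1_powR (1 - r) x0).
  by rewrite /GRing.scale/= mulrA mulVf// mul1r addrAC subrr add0r.
rewrite (@continuous_FTC2 _ _ F)//.
- by rewrite -EFinB /F -mulrBr mulrC.
- exact: within_continuous_powR.
- have cF : {within `[a, b], continuous F}.
    apply: continuous_in_subspaceT => x /set_mem/=.
    rewrite in_itv/= => /andP[ax _]; have x0 := lt_le_trans a0 ax.
    by apply: differentiable_continuous; apply/derivable1_diffP; case: (dF x x0).
  split.
  + move=> x; rewrite in_itv/= => /andP[ax _].
    by case: (dF x (lt_trans a0 ax)).
  + by case/(continuous_within_itvP _ ab): cF.
  + by case/(continuous_within_itvP _ ab): cF.
- move=> x; rewrite in_itv/= => /andP[ax _].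
  by rewrite derive1E; case: (dF x (lt_trans a0 ax)).
Qed.

(** * Integrability of the weight *)

(** Reduces the line to segments [[a, b]] away from 0: reflection pairs [[-b, -a]] with [[a, b]],
    and monotone convergence along an exhaustion of the nonzero reals passes the bound to the
    limit. *)
Lemma integral_even_le (R : realType) (f : R -> R) (M : R) :
  measurable_fun setT f -> (forall x, 0 <= f x) -> (forall x, f (- x) = f x) ->
  (forall x, x != 0 -> {for x, continuous f}) ->
  (forall a b, 0 < a < 1 -> 1 < b ->
     (\int[lebesgue_measure]_(x in `[a, b]) (f x)%:E <= M%:E)%E) ->
  (\int[lebesgue_measure]_x (f x)%:E <= (M + M)%:E)%E.
Proof.
move=> mf f0 fN cf fM.
have mf' (A : set R) : measurable_fun A (fun x => (f x)%:E).
  by apply/measurable_EFinP; exact: measurable_funS mf.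
(* The shift by 2 ensures [0 < a n < 1 < b n] already at [n = 0]. *)
pose b (n : nat) : R := n%:R + 2; pose a n := (b n)^-1.
have b1 n : 1 < b n by rewrite /b; have := ler0n R n; lra.
have b0 n : 0 < b n := lt_trans ltr01 (b1 n).
have a01 n : 0 < a n < 1 by rewrite invr_gt0 b0 invf_lt1 ?b0// b1.
pose P n : set R := `[a n, b n]%classic.
pose N n : set R := `[- b n, - a n]%classic.
have -> : (\int[lebesgue_measure]_x (f x)%:E =
    \int[lebesgue_measure]_(x in \bigcup_n (P n `|` N n)) (f x)%:E)%E.
  rewrite -(@integral_setD1 _ _ 0 setT)//; last first.
    exact: measurableD.
  congr (integral _ _ _); apply/seteqP; split => x /=; last first.
    move=> [n _]; have /andP[an0 _] := a01 n.
    rewrite /P /N/= !in_itv/= => -[|] /andP[h1 h2]; split => //; apply/eqP.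
      by rewrite gt_eqF// (lt_le_trans an0).
    by rewrite lt_eqF// (le_lt_trans h2)// oppr_lt0.
  move=> [_ /eqP x0].
  have nx : 0 < `|x| by rewrite normr_gt0.
  (* Large enough that both [|x|] and its inverse lie below [b n]; the latter means [a n < |x|]. *)
  pose n := Num.truncn (Num.max `|x| `|x|^-1).
  have hm : Num.max `|x| `|x|^-1 < b n.
    rewrite /b /n; apply: lt_trans (truncnS_gt _) _.
    by rewrite -addn1 natrD ltrD2l ltr1n.
  have xb : `|x| < b n by apply: le_lt_trans hm; rewrite le_max lexx.
  have ax : a n < `|x|.
    rewrite /a -[ltRHS]invrK ltf_pV2 ?posrE ?invr_gt0 ?b0//.
    by apply: le_lt_trans hm; rewrite le_max lexx orbT.
  exists n => //; rewrite /P /N/= !in_itv/=.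
  have [x_ge0|x_lt0] := leP 0 x.
    by left; move: ax xb; rewrite ger0_norm// => /ltW-> /ltW->.
  right; move: ax xb; rewrite ltr0_norm// => ax xb.
  by rewrite lerNl (ltW xb) lerNr (ltW ax).
have mP n : measurable (P n `|` N n).
  by apply: measurableU; exact: measurable_itv.
have bD (m n : nat) : (m <= n)%N -> b m <= b n.
  by move=> mn; rewrite /b lerD2r ler_nat.
have aD (m n : nat) : (m <= n)%N -> a n <= a m.
  by move=> mn; rewrite lef_pV2 ?posrE ?b0// bD.
have ndP : nondecreasing_seq (fun n => P n `|` N n).
  move=> m n mn; rewrite subsetEset => x [|]; rewrite /P /N/= !in_itv/=;
    move=> /andP[h1 h2]; [left|right]; apply/andP; split.
  - exact: le_trans (aD _ _ mn) h1.
  - exact: le_trans h2 (bD _ _ mn).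
  - by apply: le_trans h1; rewrite lerN2 bD.
  - by apply: (le_trans h2); rewrite lerN2 aD.
have cvg : (\int[lebesgue_measure]_(x in P n `|` N n) (f x)%:E)%E @[n --> \oo] -->
    (\int[lebesgue_measure]_(x in \bigcup_n (P n `|` N n)) (f x)%:E)%E.
  apply: (@ge0_nondecreasing_set_cvg_integral _ (measurableTypeR R)) => // n.
  - exact: mf'.
  - by move=> x _; rewrite lee_fin.
apply: (cvge_to_le cvg).
apply: nearW => n; have /andP[an0 an1] := a01 n.
rewrite ge0_integral_setU//; last 5 first.
- exact: measurable_itv.
- exact: measurable_itv.
- exact: mf'.
- by move=> x _; rewrite lee_fin.
- apply/disj_setPS => x []; rewrite /P /N/= !in_itv/= => /andP[h1 _] /andP[_ h2].
  by have := lt_le_trans an0 (le_trans h1 h2); rewrite oppr_gt0 ltNge (ltW an0).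
have cf' : {within N n, continuous f}.
  apply: continuous_in_subspaceT => x /set_mem.
  rewrite /N/= in_itv/= => /andP[_ h].
  by apply: cf; rewrite lt_eqF// (le_lt_trans h)// oppr_lt0.
rewrite /N integration_by_substitution_oppr//; last first.
  by rewrite ltW// (lt_trans an1).
rewrite EFinD; apply: leeD; first exact: fM (a01 n) (b1 n).
under eq_integral do rewrite /= fN.
exact: fM (a01 n) (b1 n).
Qed.

(** For [alpha <= beta] and nonzero [x], the first power is the smaller one when [|x| <= 1], the
    second when [|x| >= 1]. *)
Definition weight (R : realType) (alpha beta x : R) : R :=
  Num.min (`|x| `^ (- alpha)) (`|x| `^ (- beta)).

Lemma weight_ge0 (R : realType) (alpha beta x : R) : 0 <= weight alpha beta x.
Proof. by rewrite /weight le_min !powR_ge0. Qed.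

Lemma weight_gt0 (R : realType) (alpha beta x : R) :
  x != 0 -> 0 < weight alpha beta x.
Proof. by move=> x0; rewrite /weight lt_min !powR_gt0 ?normr_gt0. Qed.

Lemma measurable_weight (R : realType) (alpha beta : R) :
  measurable_fun setT (weight alpha beta).
Proof.
by apply: measurable_minr;
  apply: (measurableT_comp (measurable_powR _)); exact: normr_measurable.
Qed.

Lemma integral_weight_lty (R : realType) (alpha beta : R) :
  alpha < 1 -> 1 < beta ->
  (\int[lebesgue_measure]_x (weight alpha beta x)%:E < +oo)%E.
Proof.
move=> a1 b1.
have mw : measurable_fun setT (weight alpha beta) := measurable_weight _ _.
(* The constants are the limits of the integrals of [x^(-alpha)] over [[a, 1]] as [a] tends to 0,
   and of [x^(-beta)] over [[1, b]] as [b] tends to infinity. *)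
suff H : forall a b : R, 0 < a < 1 -> 1 < b ->
    (\int[lebesgue_measure]_(x in `[a, b]) (weight alpha beta x)%:E <=
     ((1 - alpha)^-1 + (beta - 1)^-1)%:E)%E.
  apply: le_lt_trans (integral_even_le mw _ _ _ H) (ltry _).
  - by move=> x; exact: weight_ge0.
  - by move=> x; rewrite /weight normrN.
  - move=> x x0; have cn (r : R) : {for x, continuous (fun x : R => `|x| `^ r)}.
      apply: (@continuous_comp _ _ _ (fun x : R => `|x|) (@powR R ^~ r)).
        exact: norm_continuous.
      by apply: continuous_powRl; rewrite normr_gt0.
    exact: continuous_min (cn _) (cn _).
move=> a b /andP[a0 a_lt1] b_gt1.
have -> : `[a, b]%classic = `[a, 1]%classic `|` `]1, b]%classic.
  by rewrite -itv_bndbnd_setU// bnd_simp ltW.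
rewrite ge0_integral_setU//; last 3 first.
- by apply/measurable_EFinP; exact: measurable_funS mw.
- by move=> x _; rewrite lee_fin weight_ge0.
- apply/disj_setPS => x []; rewrite /= !in_itv/= => /andP[_ h1] /andP[h2 _].
  by have := lt_le_trans h2 h1; rewrite ltxx.
rewrite EFinD; apply: leeD.
  apply: (@le_trans _ _
      (\int[lebesgue_measure]_(x in `[a, 1%R]) (x `^ (- alpha))%:E)%E).
    apply: ge0_le_integral_subset => // x /=; rewrite ?lee_fin ?weight_ge0 ?powR_ge0//.
    rewrite in_itv/= => /andP[ax _]; rewrite /weight.
    by rewrite ger0_norm ?ge_min ?lexx// (le_trans (ltW a0)).
  rewrite integral_powR ?lt_eqF// powR1 lee_fin ler_pdivrMr ?subr_gt0//.
  by rewrite mulVf ?gt_eqF ?subr_gt0// gerBl powR_ge0.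
(* Closing the interval at 1 can only enlarge the integral, and gives it the form evaluated by
   [integral_powR]. *)
apply: (@le_trans _ _
    (\int[lebesgue_measure]_(x in `[1%R, b]) (x `^ (- beta))%:E)%E).
  apply: ge0_le_integral_subset => // x /=; rewrite ?lee_fin ?weight_ge0 ?powR_ge0//.
    by rewrite !in_itv/= => /andP[/ltW-> ->].
  rewrite in_itv/= => /andP[/ltW x1 _]; rewrite /weight.
  by rewrite ger0_norm ?ge_min ?lexx ?orbT// (le_trans ler01).
rewrite integral_powR ?gt_eqF// powR1 lee_fin.
rewrite -mulrNN -invrN !opprB ler_pdivrMr ?subr_gt0//.
by rewrite mulVf ?gt_eqF ?subr_gt0// gerBl powR_ge0.
Qed.

(** * Double integrals dominated by a product *)

(** Pulling [w x] out of the inner integral leaves at most [w x * C], whose integral is [C * C]. The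
    values of [w] are extended reals so that it may be infinite at 0. *)
Lemma iterated_integral_lty (R : realType) (D : R -> set R) (k : R -> R -> R)
    (w : R -> \bar R) :
  measurable_fun setT w -> (forall x, 0 <= w x)%E ->
  (\int[lebesgue_measure]_x w x < +oo)%E ->
  (forall x y, 0 <= k x y) ->
  (forall x y, D x y -> (k x y)%:E <= w x * w y)%E ->
  (\int[lebesgue_measure]_x \int[lebesgue_measure]_(y in D x) (k x y)%:E < +oo)%E.
Proof.
move=> mw w0 wfin k0 kw; set C := (\int[lebesgue_measure]_x w x)%E in wfin.
have C0 : (0 <= C)%E by exact: integral_ge0.
apply: (@le_lt_trans _ _ (C * C)%E); last by apply: lte_mul_pinfty; rewrite ?ge0_fin_numE.
have -> : (C * C = \int[lebesgue_measure]_x (C * w x))%E by rewrite ge0_integralZl.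
apply: ge0_le_integral_subset => // x _.
- by apply: integral_ge0 => y _; rewrite lee_fin.
- exact: mule_ge0.
rewrite muleC /C -ge0_integralZl//; apply: ge0_le_integral_subset => // y.
- by rewrite lee_fin.
- by move=> _; exact: mule_ge0.
- exact: kw.
Qed.

(* At 0, where [powR] returns the junk value 0, the weight is replaced by its
   limit, so that the product bound on the kernel holds everywhere. *)
Definition eweight (R : realType) (alpha beta x : R) : \bar R :=
  if x == 0 then +oo%E else (weight alpha beta x)%:E.

Lemma eweight_gt0 (R : realType) (alpha beta x : R) :
  (0 < eweight alpha beta x)%E.
Proof. by rewrite /eweight; case: eqVneq => // x0; rewrite lte_fin weight_gt0. Qed.

Lemma measurable_eweight (R : realType) (alpha beta : R) :
  measurable_fun setT (eweight alpha beta).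
Proof.
apply: measurable_fun_ifT => //.
- exact: measurable_fun_eqr.
- by apply/measurable_EFinP; exact: measurable_weight.
Qed.

Lemma integral_eweight (R : realType) (alpha beta : R) :
  (\int[lebesgue_measure]_x eweight alpha beta x =
   \int[lebesgue_measure]_x (weight alpha beta x)%:E)%E.
Proof.
rewrite -[LHS](@integral_setD1 _ _ 0) ?setTD//; last 2 first.
- exact: measurableC.
- exact: measurable_funS (measurable_eweight _ _).
rewrite -[RHS](@integral_setD1 _ _ 0) ?setTD//; last 2 first.
- exact: measurableC.
- by apply/measurable_EFinP; exact: measurable_funS (measurable_weight _ _).
apply: eq_integral => x /set_mem/= x0.
by rewrite /eweight ifF//; apply/eqP.
Qed.

(** Negative powers decrease in the base, which replaces [t] by [|u|] without changing the exponent.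
    To reach the other exponent, first change it at base [t]: [t^(-alpha) <= t^(-beta)] if [t <= 1],
    and the reverse if [t >= 1]. *)
Lemma powRN_le_weight (R : realType) (alpha beta gamma t u : R) :
  0 <= alpha <= beta -> 0 < `|u| <= t ->
  (gamma = alpha /\ t <= 1) \/ (gamma = beta /\ 1 <= t) ->
  t `^ (- gamma) <= weight alpha beta u.
Proof.
move=> /andP[a0 ab] /andP[u0 ut] H; have t0 := lt_le_trans u0 ut.
have b0 := le_trans a0 ab.
rewrite /weight le_min; case: H => -[-> t1]; apply/andP; split.
- exact: ler_powRN.
- apply: le_trans (ler_powRN b0 u0 ut).
  by apply: ger_powR; rewrite ?t0// lerN2.
- apply: le_trans (ler_powRN a0 u0 ut).
  by apply: ler_powR; rewrite // lerN2.
- exact: ler_powRN.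
Qed.

(** * Upper and lower bounds for the double integral of the step function *)

Definition heaviside {R : realType} : R -> R :=
  \1_(`[0, +oo[%classic : set R).

Lemma heaviside_diff (R : realType) (p x y : R) : 0 < p ->
  `|heaviside x - heaviside y| `^ p =
  ((0 <= x) != (0 <= y))%:R :> R.
Proof.
move=> p0; rewrite /heaviside !indicE !mem_setE !in_itv/= !andbT.
case: (0 <= x); case: (0 <= y) => /=.
- by rewrite subrr normr0 powR0 ?gt_eqF.
- by rewrite subr0 normr1 powR1.
- by rewrite sub0r normrN normr1 powR1.
- by rewrite subrr normr0 powR0 ?gt_eqF.
Qed.

(** As [gamma] is half the kernel exponent, the kernel splits into one factor per variable. The
    condition on [D] keeps it on one side of distance 1, so that a single statement serves both the
    near and the far space. *)
Lemma gagliardo_heaviside_lty (R : realType) (alpha beta gamma p sigma : R)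
    (D : R -> set R) :
  0 < p -> 0 <= alpha < 1 -> 1 < beta -> 1 + sigma * p = gamma + gamma ->
  (forall x y, D x y -> (gamma = alpha /\ `|x - y| <= 1) \/
                        (gamma = beta /\ 1 <= `|x - y|)) ->
  (gagliardo D sigma p heaviside < +oo)%E.
Proof.
move=> p0 /andP[a0 a1] b1 hg DP; rewrite /gagliardo hg.
apply: (@iterated_integral_lty _ _ _ (eweight alpha beta)).
- exact: measurable_eweight.
- by move=> x; exact/ltW/eweight_gt0.
- by rewrite integral_eweight; exact: integral_weight_lty.
- by move=> x y; rewrite divr_ge0 ?powR_ge0.
move=> x y Dxy; rewrite heaviside_diff//.
have [_|hxy] /= := eqVneq (0 <= x) (0 <= y).
  by rewrite mul0r mule_ge0// ltW// eweight_gt0.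
(* Since 0 counts as nonnegative, pairs [(0, y)] with [y < 0] do contribute. The weight is infinite
   at 0 and the other factor is positive, so the product is infinite. *)
have [->|x0] := eqVneq x 0.
  by rewrite [eweight _ _ 0]/eweight eqxx gt0_mulye ?leey// eweight_gt0.
have [->|y0] := eqVneq y 0.
  by rewrite [eweight _ _ 0]/eweight eqxx gt0_muley ?leey// eweight_gt0.
rewrite /eweight (negPf x0) (negPf y0) mul1r -EFinM lee_fin -powRN opprD.
have tE : `|x - y| = `|x| + `|y|.
  have [x1|x1] := leP 0 x; have [y1|y1] := leP 0 y.
  - by move: hxy; rewrite x1 y1.
  - by rewrite (ger0_norm x1) (ltr0_norm y1) ger0_norm//; lra.
  - by rewrite (ltr0_norm x1) (ger0_norm y1) ltr0_norm//; lra.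
  - by move: hxy; rewrite !leNgt x1 y1.
rewrite powRD; last first.
  by apply/implyP => _; rewrite tE gt_eqF// ltr_wpDl// normr_gt0.
have ab : 0 <= alpha <= beta by rewrite a0 ltW// (lt_trans a1).
apply: ler_pM; rewrite ?powR_ge0//.
  by apply: (powRN_le_weight ab _ (DP _ _ Dxy)); rewrite normr_gt0 x0 tE lerDl/=.
by apply: (powRN_le_weight ab _ (DP _ _ Dxy)); rewrite normr_gt0 y0 tE lerDr/=.
Qed.

Lemma integral_cst_itv (R : realType) (k c d : R) : c <= d ->
  (\int[lebesgue_measure]_(x in `[c, d[) k%:E = (k * (d - c))%:E)%E.
Proof.
move=> cd; rewrite integral_cst//= lebesgue_measure_itv/= lte_fin.
by case: ltgtP cd => // -> _; rewrite subrr mulr0 mule0.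
Qed.

Lemma gagliardo_heaviside_ge (R : realType) (p sigma r : R) :
  0 < p -> 0 <= 1 + sigma * p -> 0 < r ->
  (((3 `^ (1 + sigma * p))^-1 * r `^ (1 - sigma * p))%:E <=
   gagliardo (fun=> setT) sigma p heaviside)%E.
Proof.
move=> p0 a0 r0; set a := 1 + sigma * p in a0 *.
have k0 (x y : R) : (0 <= (`|heaviside x - heaviside y| `^ p / `|x - y| `^ a)%:E)%E.
  by rewrite lee_fin divr_ge0 ?powR_ge0.
(* If [r <= x < 2r] and [-r <= y < 0], then [|x - y| <= 3r], so [c] bounds the kernel from below;
   each of the two integrations contributes a factor [r]. *)
pose c := ((3 * r) `^ a)^-1.
have c0 : 0 <= c by rewrite invr_ge0 powR_ge0.
have -> : ((3 `^ a)^-1 * r `^ (1 - sigma * p) = r * (r * c)).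
  have rn (P : bool) : P ==> (r != 0) by rewrite gt_eqF// implybT.
  have -> : 1 - sigma * p = 1 + (1 + - a) by rewrite /a; ring.
  rewrite (powRD (rn _)) (powRD (rn _)) (powRr1 (ltW r0)) /c.
  rewrite (powRM _ _ (ltW r0))// invfM -(powRN r).
  ring.
apply: (@le_trans _ _
    (\int[lebesgue_measure]_(x in `[r, (r + r)%R[) (r * c)%:E)%E).
  by rewrite integral_cst_itv ?lerDl ?(ltW r0)// addrK mulrC.
apply: ge0_le_integral_subset => // x.
- by rewrite lee_fin mulr_ge0// ltW.
- by move=> _; apply: integral_ge0.
rewrite /= in_itv/= => /andP[rx xr].
apply: (@le_trans _ _
    (\int[lebesgue_measure]_(y in `[(- r)%R, 0%R[) c%:E)%E).
  by rewrite integral_cst_itv ?oppr_le0 ?(ltW r0)// sub0r opprK mulrC.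
apply: ge0_le_integral_subset => // y.
rewrite /= in_itv/= => /andP[ry y0].
have x0 : 0 <= x by lra.
rewrite heaviside_diff// x0 (leNgt 0 y) y0/= mul1r lee_fin /c -!powRN.
by apply: ler_powRN; rewrite // ger0_norm; lra.
Qed.

(** * Membership in the three spaces *)

Lemma Lploc_heaviside (R : realType) (p : R) :
  0 <= p -> Lploc p (heaviside : R -> R).
Proof.
move=> p0; split; first exact: measurable_indic.
move=> K cK; apply: le_lt_trans (compact_finite_measure cK).
rewrite -[leRHS]mul1e -integral_cst; last exact: compact_measurable.
apply: ge0_le_integral_subset => // x _; rewrite lee_fin ?powR_ge0//.
have -> : 1 = 1 `^ p :> R by rewrite powR1.
apply: ge0_ler_powR => //; rewrite ?nnegrE//.
by rewrite /heaviside indicE; case: (_ \in _); rewrite ?normr1 ?normr0.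
Qed.

Lemma heaviside_Wtilde_le1 (R : realType) (p sigma : R) :
  0 < p -> -1 <= sigma * p < 1 -> Wtilde_le1 sigma p (heaviside : R -> R).
Proof.
move=> p0 hs; split; first exact/Lploc_heaviside/ltW.
(* Near the diagonal [gamma = alpha], which is below 1 because [sigma * p < 1]; 2 is just some
   exponent above 1. *)
apply: (@gagliardo_heaviside_lty _ ((1 + sigma * p) / 2) 2 ((1 + sigma * p) / 2));
  rewrite //; [lra|lra|lra|].
by move=> x y /= xy; left; split => //; exact: ltW.
Qed.

Lemma heaviside_Wtilde_ge1 (R : realType) (p sigma : R) :
  0 < p -> 1 < sigma * p -> Wtilde_ge1 sigma p (heaviside : R -> R).
Proof.
move=> p0 hs; split; first exact/Lploc_heaviside/ltW.
(* Far from the diagonal [gamma = beta], which exceeds 1 because [sigma * p > 1]; 0 is just some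
   exponent in [[0, 1[]. *)
apply: (@gagliardo_heaviside_lty _ 0 ((1 + sigma * p) / 2) ((1 + sigma * p) / 2));
  rewrite //; [lra|lra|lra|].
by move=> x y /= xy; right.
Qed.

Lemma heaviside_notin_Wdot (R : realType) (p sigma : R) :
  0 < p -> -1 <= sigma * p < 1 -> ~ Wdot sigma p (heaviside : R -> R).
Proof.
move=> p0 /andP[hs0 hs1] [_]; set I := gagliardo _ _ _ _ => Ifin.
have a0 : 0 <= 1 + sigma * p by lra.
pose b := 1 - sigma * p; have b0 : 0 < b by rewrite subr_gt0.
have I0 : (0 <= I)%E.
  apply: integral_ge0 => x _; apply: integral_ge0 => y _.
  by rewrite lee_fin divr_ge0 ?powR_ge0.
have IE : I = (fine I)%:E by rewrite fineK// ge0_fin_numE.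
have M0 : 0 <= fine I by exact: fine_ge0.
pose C := 3 `^ (1 + sigma * p) : R.
have C0 : 0 < C by rewrite powR_gt0.
(* This solves [C^-1 * r^b = fine I + 1], so the lower bound reads [fine I + 1 <= fine I]. *)
pose r := (C * (fine I + 1)) `^ b^-1.
have CI0 : 0 < C * (fine I + 1) by rewrite mulr_gt0// ltr_wpDl.
have r0 : 0 < r by rewrite powR_gt0.
have := gagliardo_heaviside_ge p0 a0 r0; rewrite -/I IE lee_fin -/C -/b.
rewrite /r -powRrM mulVf ?gt_eqF// (powRr1 (ltW CI0)).
by rewrite mulKf ?gt_eqF//; lra.
Qed.

Theorem mainTheorem3 (R : realType) (p s : R)
  (hp : 1 <= p) (hs0 : 0 < s) (hs1 : s < 1)
  (hsp1 : 1 < s * p) (hsp2 : s * p < 2) :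
  (\1_(`[0, +oo[%classic : set R) : R -> R) \in
    (Wtilde_le1 (s - p^-1) p `&` Wtilde_ge1 (s + p^-1) p)
      `\` Wdot (s - p^-1) p.
Proof.
have p0 : 0 < p := lt_le_trans ltr01 hp.
(* The threshold is [sigma * p = 1]: here [s * p - 1] lies in []0, 1[], while [s * p + 1] exceeds
   2. *)
have eB : (s - p^-1) * p = s * p - 1 by rewrite mulrBl mulVf ?gt_eqF.
have eD : (s + p^-1) * p = s * p + 1 by rewrite mulrDl mulVf ?gt_eqF.
apply/mem_set; split; [split|].
- by apply: heaviside_Wtilde_le1; rewrite // eB; lra.
- by apply: heaviside_Wtilde_ge1; rewrite // eD; lra.
- by apply: heaviside_notin_Wdot; rewrite // eB; lra.
Qed.
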